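(* Let $\Lambda$ be a row-finite $k$-graph without sources, and let $\overline{\Lambda}=\Lambda\times_d\mathbb{Z}^k$ be the skew-product $k$-graph. Then: (i) there is a forgetful homomorphism of monoids $\pi:T_\Lambda\to M_\Lambda$ given by $v(i)\mapsto v$. Furthermore, $T_\Lambda/\langle v=v(n):\ v\in\Lambda^0,\ n\in\mathbb{Z}^k\rangle\cong M_\Lambda$, where the left-hand side is the quotient of $T_\Lambda$ by the monoid congruence generated by the pairs $(v(0),v(n))$; (ii) the map $\phi:T_\Lambda\to M_{\overline{\Lambda}}$ defined by $v(n)\mapsto(v,n)$ induces a $\mathbb{Z}^k$-monoid isomorphism.
   Context: **$k$-graphs.** $\mathbb{N}=\{0,1,2,\dots\}$, $k\ge 1$, $e_i$ is the $i$-th standard generator of $\mathbb{N}^k$. A $k$-graph is a countable small category $\Lambda$ with object set $\Lambda^0$ (identified with the identity morphisms), range and source maps $r,s:\Lambda\to\Lambda^0$, and a functor $d:\Lambda\to\mathbb{N}^k$ with the unique factorization property: if $d(\lambda)=m+n$ there are unique $\mu_1,\mu_2\in\Lambda$ with $\lambda=\mu_1\mu_2$, $d(\mu_1)=m$, $d(\mu_2)=n$ (the product $\mu_1\mu_2$ is defined iff $s(\mu_1)=r(\mu_2)$). $v\Lambda^n=\{\lambda: r(\lambda)=v, d(\lambda)=n\}$. $\Lambda$ is row-finite if every $v\Lambda^n$ is finite, and has no sources if every $v\Lambda^n$ is nonempty. **$k$-graph monoid.** $M_\Lambda$ is the quotient of the free commutative monoid $\mathbb{N}\Lambda^0$ by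 the congruence generated by the pairs $\big(v,\sum_{\lambda\in v\Lambda^{e_i}}s(\lambda)\big)$ for $v\in\Lambda^0$ and $i\in\{1,\dots,k\}$ with $v\Lambda^{e_i}\ne\emptyset$. **Talented monoid.** $T_\Lambda$ is the commutative monoid generated by symbols $v(n)$ ($v\in\Lambda^0$, $n\in\mathbb{Z}^k$) subject to $v(n)=\sum_{\alpha\in v\Lambda^{e_i}}s(\alpha)(n+e_i)$ for all $v$, $n$ and $i$ with $v\Lambda^{e_i}\neq\emptyset$. $\mathbb{Z}^k$ acts on it by monoid automorphisms determined by ${}^{n}v(m)=v(m+n)$. **Skew product.** $\overline{\Lambda}=\Lambda\times_d\mathbb{Z}^k$ has morphisms $\Lambda\times\mathbb{Z}^k$, objects $\Lambda^0\times\mathbb{Z}^k$, $r(\lambda,n)=(r(\lambda),n)$, $s(\lambda,n)=(s(\lambda),n+d(\lambda))$, $(\lambda,n)(\mu,n+d(\lambda))=(\lambda\mu,n)$, and degree $d(\lambda,n)=d(\lambda)$. $\mathbb{Z}^k$ acts on $M_{\overline{\Lambda}}$ by ${}^{n}(v,i)=(v,i+n)$ on generators. A $\mathbb{Z}^k$-monoid isomorphism is an equivariant monoid isomorphism. *)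

(* Defs.v *)
From HB Require Import structures.
From mathcomp Require Import all_boot all_order all_algebra.
From mathcomp Require Import finmap multiset.
From mathcomp Require Import boolp classical_sets functions cardinality fsbigop.

Set Implicit Arguments.
Unset Strict Implicit.
Unset Printing Implicit Defensive.

Import GRing.Theory.

Local Open Scope classical_set_scope.
Local Open Scope ring_scope.
Local Open Scope quotient_scope.

Inductive congr_gen (M : nmodType) (R : M -> M -> Prop) : M -> M -> Prop :=
| congr_base x y : R x y -> congr_gen R x y
| congr_refl x : congr_gen R x x
| congr_sym x y : congr_gen R x y -> congr_gen R y x
| congr_trans y x z : congr_gen R x y -> congr_gen R y z -> congr_gen R x z
| congr_add x x' y y' :
    congr_gen R x x' -> congr_gen R y y' -> congr_gen R (x + y) (x' + y').

Section CongruenceQuotient.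
Variables (M : nmodType) (R : M -> M -> Prop).

Definition congr_rel : rel M := fun x y => `[< congr_gen R x y >].

Fact congr_rel_refl : reflexive congr_rel.
Proof. by move=> x; apply/asboolP; exact: congr_refl. Qed.

Fact congr_rel_sym : symmetric congr_rel.
Proof. by move=> x y; apply/asboolP/asboolP; exact: congr_sym. Qed.

Fact congr_rel_trans : transitive congr_rel.
Proof.
by move=> y x z /asboolP xy /asboolP yz; apply/asboolP; exact: congr_trans xy yz.
Qed.

Canonical congr_equiv :=
  EquivRel congr_rel congr_rel_refl congr_rel_sym congr_rel_trans.

Definition congr_quot : Type := {eq_quot congr_equiv}.
HB.instance Definition _ := Choice.on congr_quot.
HB.instance Definition _ := EqQuotient.on congr_quot.

Definition congr_pi (x : M) : congr_quot := \pi_congr_quot x.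

Lemma congr_piP x y : congr_pi x = congr_pi y <-> congr_gen R x y.
Proof.
split=> [/eqP|xy]; first by rewrite /congr_pi eqmodE => /asboolP.
by apply/eqP; rewrite /congr_pi eqmodE; apply/asboolP.
Qed.

Lemma congr_repr x : congr_gen R (repr (congr_pi x)) x.
Proof. by apply/congr_piP; rewrite /congr_pi reprK. Qed.

Lemma congr_reprK x : congr_pi (repr x) = x.
Proof. exact: reprK. Qed.

Definition congr_quot_add (x y : congr_quot) := congr_pi (repr x + repr y).

Lemma congr_quot_addE x y :
  congr_quot_add (congr_pi x) (congr_pi y) = congr_pi (x + y).
Proof. by apply/congr_piP; apply: congr_add; exact: congr_repr. Qed.

Fact congr_quot_addA : associative congr_quot_add.
Proof.
move=> x y z; rewrite -(congr_reprK x) -(congr_reprK y) -(congr_reprK z).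
by rewrite !congr_quot_addE addrA.
Qed.

Fact congr_quot_addC : commutative congr_quot_add.
Proof. by move=> x y; rewrite /congr_quot_add addrC. Qed.

Fact congr_quot_add0 : left_id (congr_pi 0) congr_quot_add.
Proof. by move=> x; rewrite -(congr_reprK x) congr_quot_addE add0r. Qed.

HB.instance Definition _ := GRing.isNmodule.Build congr_quot
  congr_quot_addA congr_quot_addC congr_quot_add0.

Fact congr_pi_is_nmod_morphism : nmod_morphism congr_pi.
Proof. by split=> // x y; rewrite -congr_quot_addE. Qed.

HB.instance Definition _ :=
  GRing.isNmodMorphism.Build M congr_quot congr_pi congr_pi_is_nmod_morphism.

End CongruenceQuotient.

Definition congr_lift (M N : nmodType) (R : M -> M -> Prop) (f : {additive M -> N})
  (_ : forall x y, R x y -> f x = f y) (x : congr_quot R) : N := f (repr x).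

Section CongruenceLift.
Variables (M N : nmodType) (R : M -> M -> Prop) (f : {additive M -> N}).
Hypothesis fR : forall x y, R x y -> f x = f y.

Lemma congr_gen_eq x y : congr_gen R x y -> f x = f y.
Proof.
elim=> {x y} [x y /fR//|//|x y _ ->//|y x z _ -> _ ->//|x x' y y' _ Ex _ Ey].
by rewrite !raddfD Ex Ey.
Qed.

Lemma congr_liftE x : congr_lift fR (congr_pi R x) = f x.
Proof. by apply: congr_gen_eq; exact: congr_repr. Qed.

Fact congr_lift_is_nmod_morphism : nmod_morphism (congr_lift fR).
Proof.
split; first by rewrite -(raddf0 (congr_pi R)) congr_liftE raddf0.
move=> x y; rewrite -(congr_reprK x) -(congr_reprK y) -raddfD !congr_liftE.
exact: raddfD.
Qed.

HB.instance Definition _ := GRing.isNmodMorphism.Build (congr_quot R) N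
  (congr_lift fR) congr_lift_is_nmod_morphism.

End CongruenceLift.

(** The free commutative monoid on [X]: finite multisets under sum. *)
Definition free_cmonoid (X : choiceType) : Type := multiset X.

Section FreeCommutativeMonoid.
Variable X : choiceType.

HB.instance Definition _ := Choice.on (free_cmonoid X).

Fact free_addA : associative (@msetD X : free_cmonoid X -> _ -> free_cmonoid X).
Proof. by move=> A B C; apply/msetP => x; rewrite !msetE2 addnA. Qed.

Fact free_addC : commutative (@msetD X : free_cmonoid X -> _ -> free_cmonoid X).
Proof. by move=> A B; apply/msetP => x; rewrite !msetE2 addnC. Qed.

Fact free_add0 :
  left_id (mset0 : free_cmonoid X) (@msetD X : free_cmonoid X -> _ -> free_cmonoid X).
Proof. by move=> A; apply/msetP => x; rewrite msetE2 mset0E. Qed.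

HB.instance Definition _ := GRing.isNmodule.Build (free_cmonoid X)
  free_addA free_addC free_add0.

Definition free_gen (x : X) : free_cmonoid X := [mset x]%mset.

Lemma free_gen_neq0 x : free_gen x <> 0.
Proof. by move/msetP => /(_ x); rewrite msetnxx mset0E. Qed.

Variables (N : nmodType) (f : X -> N).

Definition free_lift (A : free_cmonoid X) : N := \sum_(x <- finsupp A) f x *+ A x.

Lemma free_lift_widen (A : free_cmonoid X) (s : {fset X}) : (finsupp A `<=` s)%fset ->
  free_lift A = \sum_(x <- s) f x *+ A x.
Proof.
move=> As; rewrite /free_lift; apply: big_fset_incl => // x _.
by rewrite memNfinsupp => /eqP ->.
Qed.

Fact free_lift_is_nmod_morphism : nmod_morphism free_lift.
Proof.
split; first by rewrite /free_lift finsupp0 big_seq_fset0.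
move=> A B.
rewrite (@free_lift_widen A (finsupp A `|` finsupp B)%fset) ?fsubsetUl//.
rewrite (@free_lift_widen B (finsupp A `|` finsupp B)%fset) ?fsubsetUr//.
rewrite (@free_lift_widen (A + B) (finsupp A `|` finsupp B)%fset).
  by rewrite -big_split/=; apply: eq_bigr => x _; rewrite -mulrnDr msetE2.
by apply/fsubsetP => x; rewrite in_fsetU !msuppE in_msetD.
Qed.

HB.instance Definition _ := GRing.isNmodMorphism.Build (free_cmonoid X) N
  free_lift free_lift_is_nmod_morphism.

Lemma free_liftE x : free_lift (free_gen x) = f x.
Proof.
rewrite (@free_lift_widen _ [fset x]%fset) ?big_seq_fset1 ?msetnxx//.
by apply/fsubsetP => y; rewrite msuppE in_mset1 in_fset1.
Qed.

End FreeCommutativeMonoid.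

Lemma free_genE (X : choiceType) (A : free_cmonoid X) :
  A = \sum_(x <- finsupp A) free_gen x *+ A x.
Proof.
apply/msetP => y; pose ev (B : free_cmonoid X) : nat := B y.
have evD B C : ev (B + C) = (ev B + ev C)%N by rewrite /ev msetE2.
have ev0 : ev 0 = 0%N by exact: mset0E.
have evM x n : ev (free_gen x *+ n) = ((y == x) * n)%N.
  elim: n => [|n IHn]; first by rewrite mulr0n muln0.
  by rewrite mulrS evD IHn /ev /free_gen msetnE mulnS; case: (y == x).
rewrite -[RHS]/(ev _) (big_morph ev evD ev0).
under eq_bigr do rewrite evM.
have [yA|yA] := boolP (y \in finsupp A); last first.
  rewrite (memNfinsupp _ _ ) in yA; move/eqP: (yA) => ->.
  rewrite big_seq big1// => x xA; case: eqP => [yx|]; last by rewrite mul0n.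
  by move: xA; rewrite -yx mem_finsupp yA.
rewrite (big_fsetD1 y)//= eqxx mul1n big_seq big1 ?addn0// => x.
by rewrite in_fsetD1 eq_sym => /andP[/negbTE-> _]; rewrite mul0n.
Qed.

Lemma free_additive_ext (X : choiceType) (N : nmodType)
    (f g : {additive free_cmonoid X -> N}) :
  (forall x, f (free_gen x) = g (free_gen x)) -> f =1 g.
Proof.
move=> fg A; rewrite [A]free_genE !raddf_sum; apply: eq_bigr => x _.
by rewrite !raddfMn fg.
Qed.

Lemma free_additive_fsum (X Y I : choiceType) (g : X -> Y)
    (h : {additive free_cmonoid X -> free_cmonoid Y}) (D : set I) (F : I -> X) :
  (forall x, h (free_gen x) = free_gen (g x)) ->
  h (\sum_(f \in D) free_gen (F f)) = \sum_(f \in D) free_gen (g (F f)).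
Proof.
move=> hg.
have suppD (Z : choiceType) (G : I -> Z) :
    D `&` (fun f => free_gen (G f)) @^-1` [set~ 0] = D.
  by apply/seteqP; split=> [f []|f Df]//; split=> //; exact: free_gen_neq0.
have [Dfin|Dinf] := pselect (finite_set D).
  by rewrite !fsbig_finite// raddf_sum; apply: eq_bigr => f _; exact: hg.
rewrite fsbig_dflt ?suppD// raddf0 fsbig_dflt//.
by rewrite (suppD _ (fun f => g (F f))).
Qed.

Definition monoid_isomorphic (M N : nmodType) : Prop :=
  exists f : {additive M -> N}, bijective f.

(** Objects are kept apart from morphisms; [kid] is the embedding of the former
    as identity morphisms. Composition [f g] follows the paths convention: it is
    defined when the source of [f] is the range of [g]. Countability of the
    category is carried by the [countType] structures. *)
Record kgraph (k : nat) := KGraph {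
  kobj : countType;
  kmor : countType;
  krange : kmor -> kobj;
  ksource : kmor -> kobj;
  kid : kobj -> kmor;
  kcomp : forall f g : kmor, ksource f = krange g -> kmor;
  kdeg : kmor -> 'rV[nat]_k;
  krange_id : forall v, krange (kid v) = v;
  ksource_id : forall v, ksource (kid v) = v;
  krange_comp : forall f g (fg : ksource f = krange g),
    krange (kcomp fg) = krange f;
  ksource_comp : forall f g (fg : ksource f = krange g),
    ksource (kcomp fg) = ksource g;
  kcomp_idl : forall f (e : ksource (kid (krange f)) = krange f), kcomp e = f;
  kcomp_idr : forall f (e : ksource f = krange (kid (ksource f))), kcomp e = f;
  kcompA : forall f g h (fg : ksource f = krange g) (gh : ksource g = krange h)
    (fg_h : ksource (kcomp fg) = krange h) (f_gh : ksource f = krange (kcomp gh)),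
    kcomp fg_h = kcomp f_gh;
  kdeg_id : forall v, kdeg (kid v) = 0;
  kdeg_comp : forall f g (fg : ksource f = krange g),
    kdeg (kcomp fg) = kdeg f + kdeg g;
  kfactor : forall f m n, kdeg f = m + n ->
    exists! p : kmor * kmor, exists e : ksource p.1 = krange p.2,
      [/\ f = kcomp e, kdeg p.1 = m & kdeg p.2 = n]
}.

Definition kpaths (k : nat) (L : kgraph k) (v : kobj L) (n : 'rV[nat]_k) :
  set (kmor L) := [set f | krange f = v /\ kdeg f = n].

Definition row_finite (k : nat) (L : kgraph k) : Prop :=
  forall (v : kobj L) (n : 'rV[nat]_k), finite_set (kpaths v n).

Definition no_sources (k : nat) (L : kgraph k) : Prop :=
  forall (v : kobj L) (n : 'rV[nat]_k), kpaths v n !=set0.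

Definition unit_deg (k : nat) (i : 'I_k) : 'rV[nat]_k := delta_mx 0 i.

Definition deg_int (k : nat) (n : 'rV[nat]_k) : 'rV[int]_k := map_mx Posz n.

Lemma deg_int0 k : deg_int (0 : 'rV[nat]_k) = 0.
Proof. by apply/rowP => i; rewrite !mxE. Qed.

Lemma deg_intD k (m n : 'rV[nat]_k) : deg_int (m + n) = deg_int m + deg_int n.
Proof. by apply/rowP => i; rewrite !mxE. Qed.

(** The sum is over a finite set as soon as [L] is row-finite; the convention of
    [\sum_(_ \in _)] on infinite supports is irrelevant in that case. *)
Inductive kmonoid_rel (k : nat) (L : kgraph k) :
    free_cmonoid (kobj L) -> free_cmonoid (kobj L) -> Prop :=
| KMonoidRel (v : kobj L) (i : 'I_k) : kpaths v (unit_deg i) !=set0 ->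
    kmonoid_rel (free_gen v)
      (\sum_(f \in kpaths v (unit_deg i)) free_gen (ksource f)).

Definition kmonoid (k : nat) (L : kgraph k) : nmodType :=
  congr_quot (@kmonoid_rel k L).

Definition kmonoid_gen (k : nat) (L : kgraph k) (v : kobj L) : kmonoid L :=
  congr_pi (@kmonoid_rel k L) (free_gen v).

(** The pairs (v, n) index the generators v(n) of the talented monoid, and are
    the objects of the skew product. *)
Definition graded_obj (k : nat) (L : kgraph k) : countType :=
  (kobj L * 'rV[int]_k)%type.

Inductive talented_rel (k : nat) (L : kgraph k) :
    free_cmonoid (graded_obj L) -> free_cmonoid (graded_obj L) -> Prop :=
| TalentedRel (v : kobj L) (n : 'rV[int]_k) (i : 'I_k) :
    kpaths v (unit_deg i) !=set0 ->
    talented_rel (free_gen ((v, n) : graded_obj L))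
      (\sum_(f \in kpaths v (unit_deg i))
         free_gen ((ksource f, n + deg_int (unit_deg i)) : graded_obj L)).

Definition talented (k : nat) (L : kgraph k) : nmodType :=
  congr_quot (@talented_rel k L).

Definition talented_gen (k : nat) (L : kgraph k) (v : kobj L) (n : 'rV[int]_k) :
  talented L := congr_pi (@talented_rel k L) (free_gen ((v, n) : graded_obj L)).

Inductive forget_rel (k : nat) (L : kgraph k) : talented L -> talented L -> Prop :=
| ForgetRel (v : kobj L) (n : 'rV[int]_k) :
    forget_rel (talented_gen v 0) (talented_gen v n).

Section SkewProduct.
Variables (k : nat) (L : kgraph k).

Let obj : countType := graded_obj L.
Let mor : countType := (kmor L * 'rV[int]_k)%type.

Definition skew_range (f : mor) : obj := (krange f.1, f.2).
Definition skew_source (f : mor) : obj := (ksource f.1, f.2 + deg_int (kdeg f.1)).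
Definition skew_id (v : obj) : mor := (kid v.1, v.2).
Definition skew_deg (f : mor) : 'rV[nat]_k := kdeg f.1.

Fact skew_composable (f g : mor) :
  skew_source f = skew_range g -> ksource f.1 = krange g.1.
Proof. by case. Qed.

Definition skew_comp (f g : mor) (fg : skew_source f = skew_range g) : mor :=
  (kcomp (skew_composable fg), f.2).

Fact skew_range_id v : skew_range (skew_id v) = v.
Proof. by case: v => v n; rewrite /skew_range/= krange_id. Qed.

Fact skew_source_id v : skew_source (skew_id v) = v.
Proof. by case: v => v n; rewrite /skew_source/= ksource_id kdeg_id deg_int0 addr0. Qed.

Fact skew_range_comp f g (fg : skew_source f = skew_range g) :
  skew_range (skew_comp fg) = skew_range f.
Proof. by rewrite /skew_range/= krange_comp. Qed.

Fact skew_source_comp f g (fg : skew_source f = skew_range g) :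
  skew_source (skew_comp fg) = skew_source g.
Proof.
rewrite /skew_source/= ksource_comp kdeg_comp deg_intD addrA.
by case: (fg) => _ ->.
Qed.

Fact skew_comp_idl f (e : skew_source (skew_id (skew_range f)) = skew_range f) :
  skew_comp e = f.
Proof. by case: f e => f n e; rewrite /skew_comp kcomp_idl. Qed.

Fact skew_comp_idr f (e : skew_source f = skew_range (skew_id (skew_source f))) :
  skew_comp e = f.
Proof. by case: f e => f n e; rewrite /skew_comp kcomp_idr. Qed.

Fact skew_compA f g h
    (fg : skew_source f = skew_range g) (gh : skew_source g = skew_range h)
    (fg_h : skew_source (skew_comp fg) = skew_range h)
    (f_gh : skew_source f = skew_range (skew_comp gh)) :
  skew_comp fg_h = skew_comp f_gh.
Proof. by congr pair; apply: kcompA. Qed.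

Fact skew_deg_id v : skew_deg (skew_id v) = 0.
Proof. exact: kdeg_id. Qed.

Fact skew_deg_comp f g (fg : skew_source f = skew_range g) :
  skew_deg (skew_comp fg) = skew_deg f + skew_deg g.
Proof. exact: kdeg_comp. Qed.

Fact skew_factor f m n : skew_deg f = m + n ->
  exists! p : mor * mor, exists e : skew_source p.1 = skew_range p.2,
    [/\ f = skew_comp e, skew_deg p.1 = m & skew_deg p.2 = n].
Proof.
case: f => f a /kfactor[[g h] [[/= e [fE gm hn]] uniq_gh]].
have e' : skew_source (g, a) = skew_range (h, a + deg_int m).
  by rewrite /skew_source /skew_range/= e gm.
exists ((g, a), (h, a + deg_int m)); split.
  exists e'; split=> //=; rewrite fE /skew_comp; congr pair.
  by rewrite (eq_irrelevance (skew_composable e') e).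
move=> [[g' b] [h' c]] /= [e2 [[f2 ab] g2 h2]].
have [-> ->] : (g, h) = (g', h').
  by apply: uniq_gh; exists (skew_composable e2).
by case: (e2) => _ <-; rewrite -ab -g2.
Qed.

Definition skew_product : kgraph k :=
  KGraph skew_range_id skew_source_id skew_range_comp skew_source_comp
    skew_comp_idl skew_comp_idr skew_compA skew_deg_id skew_deg_comp skew_factor.

End SkewProduct.

Section Actions.
Variables (k : nat) (L : kgraph k).

Definition shift_obj (n : 'rV[int]_k) (p : graded_obj L) : graded_obj L :=
  (p.1, p.2 + n).

Definition free_shift (n : 'rV[int]_k) :
    {additive free_cmonoid (graded_obj L) -> free_cmonoid (graded_obj L)} :=
  free_lift (fun p => free_gen (shift_obj n p)).

Lemma free_shiftE n p : free_shift n (free_gen p) = free_gen (shift_obj n p).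
Proof. exact: free_liftE. Qed.

Lemma free_shift_fsum (I : choiceType) (D : set I) n (F : I -> graded_obj L) :
  free_shift n (\sum_(f \in D) free_gen (F f)) =
  \sum_(f \in D) free_gen (shift_obj n (F f)).
Proof. exact: (free_additive_fsum D F (free_shiftE n)). Qed.

Fact talented_shift_rel n x y : talented_rel x y ->
  congr_pi (@talented_rel k L) (free_shift n x) =
  congr_pi (@talented_rel k L) (free_shift n y).
Proof.
case=> v m i vi; apply/congr_piP; rewrite free_shiftE free_shift_fsum.
by rewrite /shift_obj [in X in congr_gen _ _ X]/= addrAC; apply/congr_base/TalentedRel.
Qed.

Definition talented_act (n : 'rV[int]_k) : {additive talented L -> talented L} :=
  congr_lift (f := congr_pi (@talented_rel k L) \o free_shift n)
    (@talented_shift_rel n).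

Lemma talented_actE n v m : talented_act n (talented_gen v m) = talented_gen v (m + n).
Proof. by rewrite [LHS]congr_liftE [LHS]/= free_shiftE. Qed.

Lemma talented_additive_ext (N : nmodType) (f g : {additive talented L -> N}) :
  (forall v n, f (talented_gen v n) = g (talented_gen v n)) -> f =1 g.
Proof.
move=> fg x; rewrite -[x]congr_reprK.
exact: (@free_additive_ext _ _ (f \o congr_pi _) (g \o congr_pi _)
  (fun p => let: (v, n) := p in fg v n)).
Qed.

Lemma talented_act0 : talented_act 0 =1 id.
Proof.
apply: (@talented_additive_ext _ _ idfun) => v n.
by rewrite talented_actE addr0.
Qed.

Lemma talented_actD m n x :
  talented_act (m + n) x = talented_act m (talented_act n x).
Proof.
apply: (@talented_additive_ext _ _ (talented_act m \o talented_act n)) => v p.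
rewrite talented_actE; symmetry.
apply: etrans (congr1 (talented_act m) (talented_actE n v p)) _.
by rewrite talented_actE (addrC m) addrA.
Qed.

Lemma skew_paths v m i : kpaths (L := skew_product L) (v, m) (unit_deg i) =
  [set (f, m) | f in kpaths v (unit_deg i)].
Proof.
apply/seteqP; split=> [[f a] [[/= fv am] fi]|_ [f [fv fi] <-]].
  by exists f => //; rewrite am.
by split=> //=; rewrite /skew_range/= fv.
Qed.

Lemma skew_paths_fsum (N : nmodType) v m i (F : graded_obj L -> N) :
  \sum_(f \in kpaths (L := skew_product L) (v, m) (unit_deg i)) F (ksource f) =
  \sum_(f \in kpaths v (unit_deg i)) F (ksource f, m + deg_int (unit_deg i)).
Proof.
rewrite skew_paths fsbig_image; last by move=> f g _ _ [].
by apply: eq_fsbigr => f; rewrite inE => -[_ <-].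
Qed.

Fact skew_shift_rel n x y : kmonoid_rel (L := skew_product L) x y ->
  congr_pi (@kmonoid_rel k (skew_product L)) (free_shift n x) =
  congr_pi (@kmonoid_rel k (skew_product L)) (free_shift n y).
Proof.
case=> -[v m] i vi; apply/congr_piP.
have vni : kpaths (L := skew_product L) (v, m + n) (unit_deg i) !=set0.
  by move: vi; rewrite !skew_paths => -[_ [f vf _]]; exists (f, m + n); exists f.
have := congr_base (KMonoidRel vni); congr congr_gen.
  exact/esym/free_shiftE.
symmetry; apply: etrans (free_shift_fsum _ n (@ksource k (skew_product L))) _.
apply: etrans (skew_paths_fsum v m i (fun p => free_gen (shift_obj n p))) _.
apply: etrans (esym (skew_paths_fsum v (m + n) i (@free_gen (graded_obj L)))).
by apply: eq_fsbigr => f _; rewrite /shift_obj/= addrAC.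
Qed.

Definition skew_act (n : 'rV[int]_k) :
    {additive kmonoid (skew_product L) -> kmonoid (skew_product L)} :=
  congr_lift (f := congr_pi (@kmonoid_rel k (skew_product L)) \o free_shift n)
    (@skew_shift_rel n).

Lemma skew_actE n (v : kobj L) m :
  skew_act n (kmonoid_gen (L := skew_product L) (v, m)) =
  kmonoid_gen (L := skew_product L) (v, m + n).
Proof. by rewrite [LHS]congr_liftE [LHS]/= free_shiftE. Qed.

Lemma skew_additive_ext (N : nmodType)
    (f g : {additive kmonoid (skew_product L) -> N}) :
  (forall p, f (kmonoid_gen p) = g (kmonoid_gen p)) -> f =1 g.
Proof.
move=> fg x; rewrite -[x]congr_reprK.
exact: (@free_additive_ext _ _ (f \o congr_pi _) (g \o congr_pi _) fg).
Qed.

Lemma skew_act0 : skew_act 0 =1 id.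
Proof.
apply: (@skew_additive_ext _ _ idfun) => -[v n].
by rewrite skew_actE addr0.
Qed.

Lemma skew_actD m n x : skew_act (m + n) x = skew_act m (skew_act n x).
Proof.
apply: (@skew_additive_ext _ _ (skew_act m \o skew_act n)) => -[v p].
rewrite skew_actE; symmetry.
apply: etrans (congr1 (skew_act m) (skew_actE n v p)) _.
by rewrite skew_actE (addrC m) addrA.
Qed.

End Actions.

(* Main.v *)
Require Import Defs.
From HB Require Import structures.
From mathcomp Require Import all_boot all_order all_algebra.
From mathcomp Require Import boolp classical_sets functions cardinality fsbigop.

Import GRing.Theory.

Local Open Scope ring_scope.

(** All the monoids involved are given by generators and relations, so an additive
    map out of one of them is the same thing as a map on generators that respects
    the relations ([presented_lift]), and it is determined by its values on
    generators ([presented_ext]). Each isomorphism is obtained from two such maps,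
    inverse to each other on generators.

    - Dropping the degree, [v(n) |-> v], turns a relation of the talented monoid
      into one of the graph monoid, and identifies [v(0)] with [v(n)]; this gives
      the forgetful map and its factorization through the quotient. In the other
      direction [v |-> [v(0)]] is well defined because, in the quotient,
      [v(0)], which is the sum of the [s(f)(e_i)], is the sum of the [s(f)(0)].
    - A path of degree [e_i] with range [(v, n)] in the skew product is a path [f]
      of degree [e_i] with range [v], and its source is [(s(f), n + e_i)]. So
      [v(n) |-> (v, n)] matches the two presentations relation by relation.

    Row-finiteness makes the sums in the relations finite, so that additive maps
    commute with them. *)

Section PresentedMonoids.
Set Implicit Arguments.
Unset Strict Implicit.
Local Open Scope classical_set_scope.

Lemma raddf_fsum (M N : nmodType) (I : choiceType) (h : {additive M -> N})
    (D : set I) (F : I -> M) : finite_set D ->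
  h (\sum_(i \in D) F i) = \sum_(i \in D) h (F i).
Proof. by move=> Dfin; rewrite !fsbig_finite// raddf_sum. Qed.

Lemma free_lift_fsum (X I : choiceType) (N : nmodType) (f : X -> N)
    (D : set I) (F : I -> X) : finite_set D ->
  free_lift f (\sum_(i \in D) free_gen (F i)) = \sum_(i \in D) f (F i).
Proof.
move=> Dfin; rewrite (raddf_fsum (free_lift f))//.
by apply: eq_fsbigr => i _; exact: free_liftE.
Qed.

(** The universal property of a commutative monoid presented by generators [X]
    and relations [R]. *)
Lemma presented_lift (X : choiceType) (R : free_cmonoid X -> free_cmonoid X -> Prop)
    (N : nmodType) (f : X -> N) :
  (forall x y, R x y -> free_lift f x = free_lift f y) ->
  exists g : {additive congr_quot R -> N},
    forall x, g (congr_pi R (free_gen x)) = f x.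
Proof.
by move=> fR; exists (congr_lift fR) => x; rewrite [LHS]congr_liftE; exact: free_liftE.
Qed.

Lemma presented_ext (X : choiceType) (R : free_cmonoid X -> free_cmonoid X -> Prop)
    (N : nmodType) (f g : {additive congr_quot R -> N}) :
  (forall x, f (congr_pi R (free_gen x)) = g (congr_pi R (free_gen x))) -> f =1 g.
Proof.
move=> fg x; rewrite -[x]congr_reprK.
exact: (@free_additive_ext _ _ (f \o congr_pi _) (g \o congr_pi _) fg).
Qed.

End PresentedMonoids.

Section GraphMonoids.
Set Implicit Arguments.
Unset Strict Implicit.
Local Open Scope classical_set_scope.
Variables (k : nat) (L : kgraph k).

(** The defining relations of the three monoids, as equations between their
    generators. *)

Lemma kmonoid_genE (v : kobj L) (i : 'I_k) :
    row_finite L -> kpaths v (unit_deg i) !=set0 ->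
  kmonoid_gen v = \sum_(f \in kpaths v (unit_deg i)) kmonoid_gen (ksource f).
Proof.
move=> rfL vi; rewrite -raddf_fsum; last exact: rfL.
by apply/congr_piP/congr_base; exact: KMonoidRel.
Qed.

Lemma talented_genE (v : kobj L) (n : 'rV[int]_k) (i : 'I_k) :
    row_finite L -> kpaths v (unit_deg i) !=set0 ->
  talented_gen v n = \sum_(f \in kpaths v (unit_deg i))
    talented_gen (ksource f) (n + deg_int (unit_deg i)).
Proof.
move=> rfL vi; rewrite -raddf_fsum; last exact: rfL.
by apply/congr_piP/congr_base; exact: TalentedRel.
Qed.

Lemma kmonoid_skew_genE (v : kobj L) (n : 'rV[int]_k) (i : 'I_k) :
    row_finite L -> kpaths v (unit_deg i) !=set0 ->
  kmonoid_gen (L := skew_product L) (v, n) =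
  \sum_(f \in kpaths v (unit_deg i))
    kmonoid_gen (L := skew_product L) (ksource f, n + deg_int (unit_deg i)).
Proof.
move=> rfL vi.
rewrite -(skew_paths_fsum v n i (@kmonoid_gen _ (skew_product L))).
have skew_fin : finite_set (kpaths (L := skew_product L) (v, n) (unit_deg i)).
  by rewrite skew_paths; apply: finite_image; exact: rfL.
rewrite -raddf_fsum//; apply/congr_piP/congr_base; apply: KMonoidRel.
by have [f vf] := vi; rewrite skew_paths; exists (f, n); exists f.
Qed.

Lemma forget_exists : row_finite L ->
  exists p : {additive talented L -> kmonoid L},
    forall v n, p (talented_gen v n) = kmonoid_gen v.
Proof.
move=> rfL.
have [|p pE] := @presented_lift (graded_obj L) (@talented_rel k L) (kmonoid L)
  (fun x => kmonoid_gen x.1).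
  move=> _ _ [v n i vi]; rewrite [LHS]free_liftE free_lift_fsum; last exact: rfL.
  exact: kmonoid_genE.
by exists p => v n; exact: pE.
Qed.

Lemma forget_quotient_isomorphic : row_finite L ->
  monoid_isomorphic (congr_quot (@forget_rel k L)) (kmonoid L).
Proof.
move=> rfL; have [p pE] := forget_exists rfL.
have pR x y : forget_rel x y -> p x = p y by case=> v n; rewrite !pE.
pose q : {additive congr_quot (@forget_rel k L) -> kmonoid L} := congr_lift pR.
pose c : {additive talented L -> congr_quot (@forget_rel k L)} :=
  congr_pi (@forget_rel k L).
have qE v n : q (c (talented_gen v n)) = kmonoid_gen v.
  by rewrite [LHS]congr_liftE.
have cE v n : c (talented_gen v n) = c (talented_gen v 0).
  by apply/congr_piP/congr_sym/congr_base.
have [|g gE] := @presented_lift (kobj L) (@kmonoid_rel k L)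
  (congr_quot (@forget_rel k L)) (fun v => c (talented_gen v 0)).
  move=> _ _ [v i vi]; rewrite [LHS]free_liftE free_lift_fsum; last exact: rfL.
  rewrite (talented_genE 0 rfL vi) (raddf_fsum c); last exact: rfL.
  by apply: eq_fsbigr => f _; rewrite cE.
exists q; exists g => x.
- rewrite -[x]congr_reprK.
  apply: (@talented_additive_ext _ _ _ (g \o (q \o c)) c) => v n /=.
  by rewrite qE [LHS]gE cE.
- apply: (@presented_ext _ _ _ (q \o g) idfun) => v /=.
  by rewrite gE qE.
Qed.

Lemma talented_skew_isomorphism : row_finite L ->
  exists phi : {additive talented L -> kmonoid (skew_product L)},
    [/\ forall v n,
          phi (talented_gen v n) = kmonoid_gen (L := skew_product L) (v, n),
        bijective phi
      & forall n x, phi (talented_act L n x) = skew_act L n (phi x)].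
Proof.
move=> rfL.
have [|phi phiE] := @presented_lift (graded_obj L) (@talented_rel k L)
  (kmonoid (skew_product L)) (@kmonoid_gen _ (skew_product L)).
  move=> _ _ [v n i vi]; rewrite [LHS]free_liftE free_lift_fsum; last exact: rfL.
  exact: kmonoid_skew_genE.
have {}phiE v n : phi (talented_gen v n) = kmonoid_gen (L := skew_product L) (v, n).
  exact: phiE.
have [|psi psiE] := @presented_lift (graded_obj L)
  (@kmonoid_rel k (skew_product L)) (talented L) (fun x => talented_gen x.1 x.2).
  move=> _ _ [[v n] i].
  rewrite skew_paths => -[_ [f vf _]]; rewrite -skew_paths.
  have vi : kpaths v (unit_deg i) !=set0 by exists f.
  rewrite [LHS]free_liftE free_lift_fsum; last first.
    by rewrite skew_paths; apply: finite_image; exact: rfL.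
  rewrite (skew_paths_fsum v n i (fun x => talented_gen x.1 x.2)).
  exact: talented_genE.
have {}psiE v n : psi (kmonoid_gen (L := skew_product L) (v, n)) = talented_gen v n.
  exact: psiE.
exists phi; split => //.
- exists psi.
  + apply: (@talented_additive_ext _ _ _ (psi \o phi) idfun) => v n /=.
    by rewrite phiE psiE.
  + apply: (@skew_additive_ext _ _ _ (phi \o psi) idfun) => -[v n] /=.
    by rewrite psiE phiE.
- move=> n.
  apply: (@talented_additive_ext _ _ _ (phi \o talented_act L n)
    (skew_act L n \o phi)) => v m.
  rewrite [RHS](congr1 (skew_act L n) (phiE v m)) skew_actE.
  by rewrite [LHS](congr1 phi (talented_actE n v m)) phiE.
Qed.

End GraphMonoids.

Theorem theorem3p16 (k : nat) (k_gt0 : (0 < k)%N) (L : kgraph k)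
    (L_row_finite : row_finite L) (L_no_sources : no_sources L) :
  ((exists p : {additive talented L -> kmonoid L},
      forall (v : kobj L) (n : 'rV[int]_k),
        p (talented_gen v n) = kmonoid_gen v)
   /\ monoid_isomorphic (congr_quot (@forget_rel k L)) (kmonoid L))
  /\
  (exists phi : {additive talented L -> kmonoid (skew_product L)},
     [/\ (forall (v : kobj L) (n : 'rV[int]_k),
            phi (talented_gen v n) = kmonoid_gen (L := skew_product L) (v, n)),
         bijective phi
       & forall (n : 'rV[int]_k) (x : talented L),
           phi (talented_act L n x) = skew_act L n (phi x)]).
Proof.
split; last exact: talented_skew_isomorphism.
by split; [exact: forget_exists | exact: forget_quotient_isomorphic].
Qed.
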